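(* Let $U$ be a two-qubit unitary with optimal unitary extent decomposition $$U=\sum_{j=1}^\chi c_jV_j,\qquad c_j\in\mathbb{C},\ V_j\in G_2,\qquad \xi(U)=\|c\|_1^2 .$$ Let $|u\rangle=(I\otimes U\otimes I)|\psi^+\rangle^{\otimes2}$ be the Choi state of $U$, where $|\psi^+\rangle=(|00\rangle+|11\rangle)/\sqrt2$, and assume that $\xi(|u\rangle)=\xi(U)$. Then the channel $\mathcal{U}(\cdot)=U(\cdot)U^\dagger$ has optimal fermionic nonlinearity decomposition $$\mathcal{U}(\cdot)=\sum_{j,k=1}^\chi c_j\overline{c_k}\,V_j(\cdot)V_k^\dagger .$$ Moreover, $\Phi(\mathcal{U})=\xi(U)$.
   Context: On $n$ qubits let $c_{2j-1}=Z^{\otimes(j-1)}\otimes X\otimes I^{\otimes(n-j)}$ and $c_{2j}=Z^{\otimes(j-1)}\otimes Y\otimes I^{\otimes(n-j)}$, $j=1,\dots,n$. The set $G_n$ of Gaussian unitaries consists of the $n$-qubit unitaries $V$ for which there is $R\in O(2n)$ with $Vc_jV^\dagger=\sum_kR_{j,k}c_k$ for all $j$; it is closed under multiplication by global phases. Pure Gaussian states: $\mathcal{G}_n=\{V|0\rangle^{\otimes n}:V\in G_n\}$. Unitary extent: $\xi(U)=\min\{\|c\|_1^2:U=\sum_jc_jK_j,\ K_j\in G_n,\ c_j\in\mathbb{C}\}$. State extent: $\xi(|\psi\rangle)=\min\{\|c\|_1^2:|\psi\rangle=\sum_jc_j|\phi_j\rangle,\ |\phi_j\rangle\in\mathcal{G}_n,\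 c_j\in\mathbb{C}\}$. In $|u\rangle$, $U$ acts on qubits 2 and 3 of the four qubits. Fermionic nonlinearity of an $n$-qubit channel: $\Phi(\mathcal{E})=\min\{\|q\|_1:\mathcal{E}(\cdot)=\sum_jq_jL_j(\cdot)R_j,\ L_j,R_j\in G_n,\ q_j\in\mathbb{R}\}$. A decomposition with complex coefficients is regarded as one with real coefficients by absorbing phases into $L_j$; it is optimal if the sum of the moduli of its coefficients equals $\Phi(\mathcal{E})$. *)

(* Defs.v *)
From mathcomp Require Export all_boot all_order all_algebra.
From mathcomp Require Export spectral.
From mathcomp Require Export mathcomp_extra boolp classical_sets reals.
From mathcomp Require Export complex mxtens.

Set Implicit Arguments.
Unset Strict Implicit.
Unset Printing Implicit Defensive.

Import Order.TTheory GRing.Theory Num.Theory.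

Local Open Scope classical_set_scope.
Local Open Scope complex_scope.
Local Open Scope sesquilinear_scope.
Local Open Scope ring_scope.

(* The reals are an arbitrary [R : realType] and the complex numbers are
   [R[i]].  Operators on n qubits are matrices of type ['M[R[i]]_(2 ^ n)]; the
   basis vector |b_1 ... b_n> has index b_1 2^(n-1) + ... + b_n, which is the
   convention of [*t], whose left factor is the most significant one. *)

Section Minimum.
Variable R : realType.

(* Each quantity below is a minimum, not merely an infimum; the default value
   0 is used only when the set has no least element. *)
Definition min_of (A : set R) : R := xget 0 (A `&` lbound A).

Lemma min_ofE (A : set R) (x : R) : A x -> lbound A x -> min_of A = x.
Proof.
move=> Ax lbx; rewrite /min_of.
by apply: xget_unique => // y [Ay lby]; apply/le_anti; rewrite lby ?lbx.
Qed.

End Minimum.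

Section Gaussian.
Variable R : realType.
Local Notation C := R[i].

Definition pauliX : 'M[C]_2 := delta_mx 0 1 + delta_mx 1 0.
Definition pauliY : 'M[C]_2 := 'i%C *: delta_mx 1 0 - 'i%C *: delta_mx 0 1.
Definition pauliZ : 'M[C]_2 := delta_mx 0 0 - delta_mx 1 1.

(* A 0 (x) A 1 (x) ... (x) A (n - 1) *)
Fixpoint tensprod (n : nat) (A : nat -> 'M[C]_2) : 'M[C]_(2 ^ n) :=
  match n return 'M[C]_(2 ^ n) with
  | 0%N => 1%:M
  | m.+1 => castmx (esym (expnS 2 m), esym (expnS 2 m))
              (A 0%N *t tensprod m (fun k => A k.+1))
  end.

(* Everything is numbered from 0: for 0 <= j < n, [majorana n j.*2] and
   [majorana n j.*2.+1] are Z on the qubits before j, followed respectively by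
   X and Y on qubit j, and the identity on the remaining qubits. *)
Definition majorana (n k : nat) : 'M[C]_(2 ^ n) :=
  tensprod n (fun l =>
    if (l < k./2)%N then pauliZ
    else if l == k./2 then (if odd k then pauliY else pauliX)
    else 1%:M).

Definition gaussian_unitary (n : nat) (V : 'M[C]_(2 ^ n)) : Prop :=
  V \is unitarymx /\
  exists O : 'M[R]_(2 * n),
    O *m O^T = 1%:M /\
    forall j : 'I_(2 * n),
      V *m majorana n j *m V^t* = \sum_k (O j k)%:C *: majorana n k.

Definition ket0 (n : nat) : 'cV[C]_(2 ^ n) :=
  \col_i (val i == 0%N)%:R.

Definition gaussian_state (n : nat) (phi : 'cV[C]_(2 ^ n)) : Prop :=
  exists V : 'M[C]_(2 ^ n), gaussian_unitary V /\ phi = V *m ket0 n.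

Definition l1norm (J : finType) (c : J -> C) : R :=
  \sum_j ComplexField.Normc.normc (c j).

Definition unitary_decomposition (n : nat) (U : 'M[C]_(2 ^ n)) (J : finType)
    (c : J -> C) (K : J -> 'M[C]_(2 ^ n)) : Prop :=
  (forall j, gaussian_unitary (K j)) /\ U = \sum_j c j *: K j.

Definition unitary_extent (n : nat) (U : 'M[C]_(2 ^ n)) : R :=
  min_of [set x | exists (m : nat) (c : 'I_m -> C) (K : 'I_m -> 'M[C]_(2 ^ n)),
                    unitary_decomposition U c K /\ x = l1norm c ^+ 2].

Definition optimal_unitary_decomposition (n : nat) (U : 'M[C]_(2 ^ n))
    (J : finType) (c : J -> C) (K : J -> 'M[C]_(2 ^ n)) : Prop :=
  unitary_decomposition U c K /\ unitary_extent U = l1norm c ^+ 2.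

Definition state_decomposition (n : nat) (psi : 'cV[C]_(2 ^ n)) (J : finType)
    (c : J -> C) (phi : J -> 'cV[C]_(2 ^ n)) : Prop :=
  (forall j, gaussian_state (phi j)) /\ psi = \sum_j c j *: phi j.

Definition state_extent (n : nat) (psi : 'cV[C]_(2 ^ n)) : R :=
  min_of [set x | exists (m : nat) (c : 'I_m -> C) (phi : 'I_m -> 'cV[C]_(2 ^ n)),
                    state_decomposition psi c phi /\ x = l1norm c ^+ 2].

Definition channel_decomposition (n : nat)
    (E : 'M[C]_(2 ^ n) -> 'M[C]_(2 ^ n)) (J : finType)
    (q : J -> C) (K L : J -> 'M[C]_(2 ^ n)) : Prop :=
  [/\ forall j, gaussian_unitary (K j),
      forall j, gaussian_unitary (L j) &
      forall X, E X = \sum_j q j *: (K j *m X *m L j)].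

(* The coefficients in this minimum are real. *)
Definition nonlinearity (n : nat)
    (E : 'M[C]_(2 ^ n) -> 'M[C]_(2 ^ n)) : R :=
  min_of [set x | exists (m : nat) (q : 'I_m -> R)
                         (K L : 'I_m -> 'M[C]_(2 ^ n)),
                    channel_decomposition E (fun j => (q j)%:C) K L /\
                    x = \sum_j `|q j|].

(* Complex coefficients are allowed here, since their phases can be absorbed
   into the [K j]. *)
Definition optimal_channel_decomposition (n : nat)
    (E : 'M[C]_(2 ^ n) -> 'M[C]_(2 ^ n)) (J : finType)
    (q : J -> C) (K L : J -> 'M[C]_(2 ^ n)) : Prop :=
  channel_decomposition E q K L /\ l1norm q = nonlinearity E.

Definition unitary_channel (n : nat) (U : 'M[C]_(2 ^ n)) :
    'M[C]_(2 ^ n) -> 'M[C]_(2 ^ n) :=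
  fun X => U *m X *m U^t*.

Definition ket (b : 'I_2) : 'cV[C]_2 := delta_mx b 0.

Definition bell : 'cV[C]_(2 ^ 2) :=
  ((Num.sqrt 2)^-1)%:C *: (ket 0 *t ket 0 + ket 1 *t ket 1).

Definition choi_state (U : 'M[C]_(2 ^ 2)) : 'cV[C]_(2 ^ 4) :=
  ((1%:M : 'M[C]_2) *t (U *t (1%:M : 'M[C]_2))) *m (bell *t bell).

End Gaussian.

Arguments min_of {R} A.

(* Main.v *)
(* The upper bound is obtained by expanding both factors of U X U'.  For the
   lower bound, finite-dimensional Hahn-Banach applied to the minimality of
   ||c||_1 over the finitely many Gaussian unitaries involved gives a matrix H
   with |tr (H K)| <= 1 for each of them and |tr (H U)| >= ||c||_1.  Since
   tr A tr B = sum_(i,j) tr (A E_ij B E_ji), an identity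
   U X U' = sum_j q_j K_j X L_j for all X yields
   |tr (H U)|^2 = sum_j q_j tr (H K_j) conj (tr (H L_j')), and the right-hand
   side is at most sum_j |q_j|.  Here ' denotes the adjoint. *)
Require Import Defs.
From mathcomp Require Import ring lra.

Set Implicit Arguments.
Unset Strict Implicit.
Unset Printing Implicit Defensive.

Import Order.TTheory GRing.Theory Num.Theory.
Local Open Scope sesquilinear_scope.
Local Open Scope complex_scope.
Local Open Scope ring_scope.

Local Notation normc := ComplexField.Normc.normc.

(** * Sublinear functionals and their successive tilting to linear ones *)

Section SublinearFunctionals.
Variables (R : realType) (V : lmodType R[i]).
Implicit Types (p q : V -> R) (u v x y : V) (t : R).

(** Homogeneity is asked only as an inequality, which shortens later checks; using it again with
    [t^-1] gives the equality in [sublinearZ]. *)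
Definition sublinear p :=
  (forall x y, p (x + y) <= p x + p y) /\
  (forall t x, 0 <= t -> p (t%:C *: x) <= t * p x).

Lemma sublinear0 p : sublinear p -> p 0 = 0.
Proof.
move=> [pD pZ]; apply/eqP; rewrite eq_le.
have := pD 0 0; have := pZ 0 0 (lexx _); rewrite scaler0 mul0r addr0.
by move=> -> /=; lra.
Qed.

Lemma sublinearZ p t x : sublinear p -> 0 <= t -> p (t%:C *: x) = t * p x.
Proof.
move=> pS t0; have [pD pZ] := pS; apply/eqP; rewrite eq_le pZ //=.
have [->|tn0] := eqVneq t 0.
  by rewrite mul0r scale0r sublinear0.
have {tn0}t0 : 0 < t by rewrite lt_def tn0.
have := pZ t^-1 (t%:C *: x); rewrite scalerA -rmorphM mulVf ?gt_eqF//.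
by rewrite scale1r invr_ge0 (ltW t0) -ler_pdivlMl // => ->.
Qed.

(* A sublinear functional below [p] that satisfies [tilt_opp] at [v]; tilting
   successively along a real basis produces a real-linear functional. *)
Definition tilt p v x : R :=
  inf [set p (x + t%:C *: v) - t * p v | t in [set t | 0 <= t]]%classic.

Section Tilt.
Variables (p : V -> R) (v : V).
Hypothesis pS : sublinear p.

Lemma tilt_le t x : 0 <= t -> tilt p v x <= p (x + t%:C *: v) - t * p v.
Proof.
move=> t0; apply: ge_inf; last by exists t.
(* Subadditivity at [- x] and [x + s v] bounds the set below, so the [inf] is a genuine infimum. *)
exists (- p (- x)) => _ [s s0 <-].
have := pS.1 (- x) (x + s%:C *: v); rewrite addKr sublinearZ //.
by lra.
Qed.

Lemma le_tilt x a :
  (forall t, 0 <= t -> a <= p (x + t%:C *: v) - t * p v) -> a <= tilt p v x.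
Proof.
move=> ax; apply: lb_le_inf => [|_ [t t0 <-]]; last exact: ax.
by exists (p (x + 0%:C *: v) - 0 * p v); exists 0 => //=.
Qed.

Lemma tilt_le_id x : tilt p v x <= p x.
Proof. by have := tilt_le x (lexx 0); rewrite scale0r mul0r addr0 subr0. Qed.

Lemma tilt_opp : tilt p v (- v) <= - p v.
Proof.
have := tilt_le (- v) ler01; rewrite scale1r addNr mul1r sublinear0 //.
by rewrite sub0r.
Qed.

(** A shift [t] for [x] and a shift [s] for [y] combine to the shift [t + s] for [x + y]; scaling
    the argument by [t] rescales the shift in the same way. *)
Lemma tilt_sublinear : sublinear (tilt p v).
Proof.
split=> [x y|t x t0].
  rewrite -lerBlDr; apply: le_tilt => t t0.
  rewrite lerBlDr -lerBlDl; apply: le_tilt => s s0.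
  rewrite lerBlDl; apply: le_trans (tilt_le _ (addr_ge0 t0 s0)) _.
  have -> : x + y + (t + s)%:C *: v = (x + t%:C *: v) + (y + s%:C *: v).
    by rewrite rmorphD scalerDl addrACA.
  by have := pS.1 (x + t%:C *: v) (y + s%:C *: v); lra.
have [->|tn0] := eqVneq t 0.
  rewrite scale0r mul0r; apply: le_trans (tilt_le_id _) _.
  by rewrite sublinear0.
have {tn0}t0 : 0 < t by rewrite lt_def tn0.
rewrite -ler_pdivrMl //; apply: le_tilt => s s0.
rewrite ler_pdivrMl //.
apply: le_trans (tilt_le _ (mulr_ge0 (ltW t0) s0)) _.
by rewrite rmorphM -scalerA -scalerDr sublinearZ ?(ltW t0)// mulrBr mulrA.
Qed.

End Tilt.

(** Tilting at [v] gives a functional with values at most [p v] at [v] and [- p v] at [- v]. Later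
    tilts only decrease it, so tightness at [v] survives. *)
Lemma sublinear_tight p (s : seq V) : sublinear p ->
  exists q, [/\ sublinear q, forall x, q x <= p x &
                forall v, v \in s -> q v + q (- v) <= 0].
Proof.
elim: s p => [|v s IHs] p pS; first by exists p.
have [q [qS qp qs]] := IHs _ (tilt_sublinear v pS).
exists q; split=> // [x|w]; first exact: le_trans (qp x) (tilt_le_id v pS x).
rewrite inE => /predU1P [->|/qs//].
have := qp v; have := qp (- v); have := tilt_opp v pS.
by have := tilt_le_id v pS v; lra.
Qed.

(** Subadditivity at [x + y] and [- y] gives [q x <= q (x + y) + q (- y)], and tightness bounds
    [q (- y)] by [- q y]. *)
Lemma tight_linear q : sublinear q -> (forall v, q v + q (- v) <= 0) ->
  (forall x y, q (x + y) = q x + q y) /\ (forall t x, q (t%:C *: x) = t * q x).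
Proof.
move=> qS qN; have qD x y : q (x + y) = q x + q y.
  have := qS.1 x y; have := qS.1 (x + y) (- y); rewrite addrK => h1 h2.
  by have := qN y; move=> ?; apply/eqP; rewrite eq_le; lra.
split=> // t x.
have qopp y : q (- y) = - q y.
  by apply/eqP; rewrite -addr_eq0 -qD addNr sublinear0.
have [t0|t0] := leP 0 t; first exact: sublinearZ.
rewrite -[t]opprK rmorphN scaleNr qopp sublinearZ ?oppr_ge0 ?(ltW t0)//.
by rewrite !mulNr.
Qed.

End SublinearFunctionals.

(** * Finite-dimensional Hahn-Banach over the reals *)

Section HahnBanach.
Variables (R : realType) (k : nat).
Local Notation C := R[i].
Local Notation V := 'rV[C]_k.

(** The first tilt, at [x0], forces [q (- x0) <= - p x0], hence contact with [p] at [x0]. The others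
    run along the real basis formed by the unit vectors and their multiples by ['i]. *)
Lemma sublinear_supported (p : V -> R) (x0 : V) : sublinear p ->
  exists q : V -> R,
    [/\ forall x y, q (x + y) = q x + q y, forall t x, q (t%:C *: x) = t * q x,
        forall x, q x <= p x & p x0 <= q x0].
Proof.
move=> pS.
have [q [qS qp qs]] := sublinear_tight
  ([seq delta_mx 0 i | i <- enum 'I_k] ++
   [seq 'i *: delta_mx 0 i | i <- enum 'I_k])
  (tilt_sublinear x0 pS).
(* Tightness is stable under sums, opposites and real multiples, so it spreads from the real basis
   to the whole space. *)
have qtD x y : q x + q (- x) <= 0 -> q y + q (- y) <= 0 ->
    q (x + y) + q (- (x + y)) <= 0.
  have := qS.1 x y; have := qS.1 (- x) (- y); rewrite -opprD.
  by lra.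
have qtN x : q x + q (- x) <= 0 -> q (- x) + q (- (- x)) <= 0.
  by rewrite opprK addrC.
have qtZ t x : q x + q (- x) <= 0 -> q (t%:C *: x) + q (- (t%:C *: x)) <= 0.
  have pos s : 0 <= s -> q x + q (- x) <= 0 ->
      q (s%:C *: x) + q (- (s%:C *: x)) <= 0.
    by move=> s0 qx; rewrite -scalerN !sublinearZ // -mulrDr mulr_ge0_le0.
  have [t0|t0] := leP 0 t; first exact: pos.
  rewrite -[t]opprK rmorphN scaleNr => qx.
  by apply/qtN/pos => //; rewrite oppr_ge0 ltW.
have qt x : q x + q (- x) <= 0.
  rewrite [x]row_sum_delta.
  apply: (big_ind (fun x => q x + q (- x) <= 0)) => [|y z|i _].
  - by rewrite oppr0 sublinear0 ?addr0.
  - exact: qtD.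
  - rewrite [x 0 i]complexE scalerDl [_ * _]mulrC -scalerA.
    apply: qtD; apply: qtZ; apply: qs; rewrite mem_cat.
      by rewrite map_f ?mem_enum.
    by apply/orP; right; apply: map_f; rewrite mem_enum.
have [qD qZ] := tight_linear qS qt.
exists q; split=> // [x|].
  exact: le_trans (qp x) (tilt_le_id x0 pS x).
have := qp (- x0); have := tilt_opp x0 pS.
have : 0 <= q x0 + q (- x0) by rewrite -qD subrr sublinear0.
by lra.
Qed.

End HahnBanach.

(** * The real-valued modulus of a complex number *)

Section ComplexNorm.
Variable R : realType.
Implicit Types z : R[i].

Lemma norm_normc z : `|z| = (normc z)%:C.
Proof. by case: z. Qed.

Lemma normc_ge0 z : 0 <= normc z.
Proof. by rewrite -ler0c -norm_normc. Qed.

Lemma normc_real (t : R) : normc t%:C = `|t|.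
Proof. by rewrite /= expr0n /= addr0 sqrtr_sqr. Qed.

Lemma normc_conj z : normc z^* = normc z.
Proof. by case: z => a b /=; rewrite sqrrN. Qed.

Lemma mulc_conj z : z * z^* = (normc z ^+ 2)%:C.
Proof. by rewrite rmorphXn -[X in X ^+ 2]norm_normc; exact/esym/sqr_normc. Qed.

Lemma normc_sum (J : finType) (F : J -> R[i]) :
  normc (\sum_j F j) <= \sum_j normc (F j).
Proof.
rewrite -lecR -norm_normc rmorph_sum /=.
by under [X in _ <= X]eq_bigr do rewrite -norm_normc; exact: ler_norm_sum.
Qed.

End ComplexNorm.

(** * From real-linear to complex-linear functionals *)

Section RealLinear.
Variables (R : realType) (V : lmodType R[i]) (q : V -> R).
Hypothesis qD : forall x y, q (x + y) = q x + q y.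
Hypothesis qZ : forall t x, q (t%:C *: x) = t * q x.

(** The only complex-linear functional with real part [q]. *)
Definition complexify (x : V) : R[i] := q x +i* (- q ('i *: x)).

Lemma complexify_is_linear : linear_for *%R complexify.
Proof.
have q0 : q 0 = 0 by have := qZ 0 0; rewrite scale0r mul0r.
have qN x : q (- x) = - q x by apply/eqP; rewrite -addr_eq0 -qD addNr q0.
have i2 : 'i%C * 'i%C = (-1)%:C :> R[i] by simpc.
move=> [a b] x y; rewrite /complexify.
have -> : a +i* b = a%:C + b%:C * 'i%C :> R[i] by simpc.
rewrite scalerDr !scalerA mulrDr mulrCA [_ * a%:C]mulrC i2 !scalerDl.
rewrite -!scalerA !qD !qZ.
by apply/eqP; rewrite eq_complex /=; apply/andP; split; apply/eqP;
  rewrite ?qZ; ring.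
Qed.

End RealLinear.

(** * Duality for the l1 norm of coefficients over a finite family of rows *)

Section Duality.
Variable R : realType.
Local Notation C := R[i].

Definition l1 k (x : 'rV[C]_k) : R := l1norm (fun i => x 0 i).

Lemma l1D k (x y : 'rV[C]_k) : l1 (x + y) <= l1 x + l1 y.
Proof.
rewrite /l1 /l1norm -big_split /=; apply: ler_sum => i _.
by rewrite mxE le_normcD.
Qed.

Lemma l1Z k (t : C) (x : 'rV[C]_k) : l1 (t *: x) = normc t * l1 x.
Proof.
rewrite /l1 /l1norm mulr_sumr; apply: eq_bigr => i _.
by rewrite mxE ComplexField.Normc.normcM.
Qed.

Lemma l1_ge0 k (x : 'rV[C]_k) : 0 <= l1 x.
Proof. by apply: sumr_ge0 => i _; exact: normc_ge0. Qed.

Lemma l1_delta k (i : 'I_k) : l1 (delta_mx 0 i : 'rV[C]_k) = 1.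
Proof.
rewrite /l1 /l1norm (bigD1 i) //= big1 => [|j ji]; rewrite mxE !eqxx ?(negPf ji).
  by rewrite addr0 (normc_real 1) normr1.
by rewrite (normc_real 0) normr0.
Qed.

(** The quotient seminorm of [l1] modulo the left kernel of [A]: the cheapest way to write [x *m A]
    as a combination of the rows of [A]. *)
Definition quotient_norm k d (A : 'M[C]_(k, d)) (x : 'rV[C]_k) : R :=
  inf [set l1 y | y in [set y : 'rV_k | y *m A = x *m A]]%classic.

Section QuotientNorm.
Variables (k d : nat) (A : 'M[C]_(k, d)).
Implicit Types x y : 'rV[C]_k.

Lemma quotient_norm_le x y : y *m A = x *m A -> quotient_norm A x <= l1 y.
Proof.
move=> yA; apply: ge_inf; last by exists y.
by exists 0 => _ [z _ <-]; exact: l1_ge0.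
Qed.

Lemma le_quotient_norm x a :
  (forall y, y *m A = x *m A -> a <= l1 y) -> a <= quotient_norm A x.
Proof.
move=> ax; apply: lb_le_inf => [|_ [y yA <-]]; last exact: ax.
by exists (l1 x); exists x.
Qed.

Lemma quotient_norm_sublinear : sublinear (quotient_norm A).
Proof.
split=> [x y|t x t0].
  rewrite -lerBlDr; apply: le_quotient_norm => x' xA.
  rewrite lerBlDr -lerBlDl; apply: le_quotient_norm => y' yA.
  rewrite lerBlDl; apply: le_trans (l1D _ _).
  by apply: quotient_norm_le; rewrite !mulmxDl xA yA.
have tA y : y *m A = x *m A -> quotient_norm A (t%:C *: x) <= t * l1 y.
  move=> yA; rewrite -[in t * _](ger0_norm t0) -normc_real -l1Z.
  by apply: quotient_norm_le; rewrite -!scalemxAl yA.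
have [te0|tn0] := eqVneq t 0; first by have := tA x erefl; rewrite te0 !mul0r.
have {tn0}t0 : 0 < t by rewrite lt_def tn0.
rewrite -ler_pdivrMl //; apply: le_quotient_norm => y yA.
by rewrite ler_pdivrMl // tA.
Qed.

End QuotientNorm.

(** A functional supporting [quotient_norm A] at [x0] vanishes on the left kernel of [A], hence
    factors through [A]; the factor is [h]. *)
Lemma l1_duality k d (A : 'M[C]_(k, d)) (x0 : 'rV[C]_k) s :
  (forall x, x *m A = x0 *m A -> s <= l1 x) ->
  exists h : 'cV[C]_d, (forall i, normc ((A *m h) i 0) <= 1) /\
    s <= normc ((x0 *m A *m h) 0 0).
Proof.
move=> sx.
have [q [qD qZ qp px0]] := sublinear_supported x0 (quotient_norm_sublinear A).
have FL := complexify_is_linear qD qZ.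
pose F := complexify q.
have F0 : F 0 = 0.
  by have := FL (-1) 0 0; rewrite scaler0 addr0 mulN1r addNr.
have FD x y : F (x + y) = F x + F y.
  by have := FL 1 x y; rewrite scale1r mul1r.
have FZ a x : F (a *: x) = a * F x.
  by have := FL a x 0; rewrite !addr0 -/F F0 addr0.
pose f : 'cV[C]_k := \col_i F (delta_mx 0 i).
have fE x : F x = (x *m f) 0 0.
  rewrite {1}[x]row_sum_delta (big_morph F FD F0) mxE.
  by apply: eq_bigr => i _; rewrite FZ !mxE.
have qker x : x *m A = 0 -> q x <= 0.
  move=> xA; apply: le_trans (qp x) _.
  apply: le_trans (quotient_norm_le (y := 0) _) _; first by rewrite mul0mx xA.
  by rewrite -(scale0r x) l1Z (normc_real 0) normr0 mul0r.
have Fker x : x *m A = 0 -> F x = 0.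
  have qker0 y : y *m A = 0 -> q y = 0.
    move=> yA; apply/eqP; rewrite eq_le qker //=.
    have := qker (- y); rewrite mulNmx yA oppr0 => /(_ erefl).
    have : q y + q (- y) = 0.
      by rewrite -qD subrr; have := qZ 0 0; rewrite scale0r mul0r.
    by lra.
  by move=> xA; rewrite /F /complexify !qker0 ?oppr0 // -scalemxAl xA scaler0.
have [h fh] : exists h, f = A *m h.
  (* [f] is annihilated by the left kernel of [A], so it lies in the column space of [A], here the
     row space of [A^T]. *)
  have /submxP[D fD] : (f^T <= A^T)%MS.
    rewrite submxE -trmx_eq0 trmx_mul trmxK; apply/eqP/row_matrixP => i.
    rewrite row0 row_mul; apply/rowP => j; rewrite ord1 -fE mxE.
    apply: Fker; rewrite -row_mul -[_ *m A]trmxK trmx_mul trmxK.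
    by rewrite mulmx_coker trmx0 row0.
  by exists D^T; rewrite -[f]trmxK fD trmx_mul trmxK.
exists h; split=> [i|].
  rewrite -fh mxE; set z := F _.
  (* Domination controls only the real part of [F]. Rotating the unit vector by [z^*] makes the
     value real, which bounds the full modulus. *)
  have : normc z ^+ 2 <= normc z.
    have <- : q (z^* *: delta_mx 0 i) = normc z ^+ 2.
      rewrite -[LHS]/(complex.Re (F (z^* *: delta_mx 0 i))) FZ -/z.
      by rewrite mulrC mulc_conj.
    apply: le_trans (qp _) _; apply: le_trans (quotient_norm_le erefl) _.
    by rewrite l1Z l1_delta mulr1 normc_conj.
  by have := normc_ge0 z; nra.
rewrite -mulmxA -fh -fE -lecR -norm_normc.
apply: le_trans (normc_ge_Re _); rewrite lecR.
apply: le_trans (ler_norm _); apply: le_trans px0.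
exact: le_quotient_norm.
Qed.

End Duality.

(** * Traces, adjoints and linear functionals on matrices *)

Section TraceFunctionals.
Variable R : realType.
Local Notation C := R[i].

Lemma trmxC_mul m n p (A : 'M[C]_(m, n)) (B : 'M[C]_(n, p)) :
  (A *m B)^t* = B^t* *m A^t*.
Proof. by rewrite trmx_mul map_mxM. Qed.

Lemma trmxCZ m n (a : C) (A : 'M[C]_(m, n)) : (a *: A)^t* = a^* *: A^t*.
Proof. by rewrite linearZ /= map_mxZ. Qed.

Lemma trmxC_sum m n (J : finType) (A : J -> 'M[C]_(m, n)) :
  (\sum_j A j)^t* = \sum_j (A j)^t*.
Proof. by rewrite linear_sum /= raddf_sum. Qed.

Lemma mxtrace_trmxC n (A : 'M[C]_n) : \tr (A^t*) = (\tr A)^*.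
Proof. by rewrite trace_map_mx mxtrace_tr. Qed.

Lemma mxtrace_mul_delta n (A : 'M[C]_n) i j : \tr (A *m delta_mx i j) = A j i.
Proof.
rewrite /mxtrace (bigD1 j) //= big1 => [|k kj]; rewrite mxE.
  rewrite addr0 (bigD1 i) //= big1 => [|k ki]; rewrite mxE !eqxx ?mulr1 ?addr0 //.
  by rewrite (negPf ki) mulr0.
by rewrite big1 // => l _; rewrite mxE (negPf kj) andbF mulr0.
Qed.

(** With matrix units, [E_ij B E_ji = B_jj E_ii], so each summand is [A_ii B_jj]. *)
Lemma mxtrace_mulE n (A B : 'M[C]_n) :
  \tr A * \tr B = \sum_i \sum_j \tr (A *m delta_mx i j *m B *m delta_mx j i).
Proof.
rewrite /mxtrace mulr_suml; apply: eq_bigr => i _; rewrite mulr_sumr.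
apply: eq_bigr => j _; rewrite -/(mxtrace _) mxtrace_mul_delta -mulmxA mxE.
rewrite (bigD1 i) //= big1 ?addr0 => [|k ki].
  congr (_ * _); rewrite mxE (bigD1 j) //= big1 ?addr0 => [|k kj].
    by rewrite mxE !eqxx mul1r.
  by rewrite mxE (negPf kj) andbF mul0r.
by rewrite mxE big1 ?mulr0 // => l _; rewrite mxE (negPf ki) mul0r.
Qed.

Lemma mxvec_mul_col n (A : 'M[C]_n) (h : 'cV[C]_(n * n)) :
  (mxvec A *m h) 0 0 = \tr ((vec_mx h^T)^T *m A).
Proof.
rewrite mxE (reindex _ (curry_mxvec_bij n n)) /=.
transitivity
  (\sum_i \sum_j mxvec A 0 (mxvec_index i j) * h (mxvec_index i j) 0).
  by rewrite pair_bigA; apply: eq_bigr => -[].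
rewrite exchange_big /=.
apply: eq_bigr => j _; rewrite mxE; apply: eq_bigr => i _.
by rewrite mxvecE !mxE mulrC.
Qed.

(** This is [l1_duality] for the matrix whose rows are the vectorized [K j]; [mxvec_mul_col] turns
    the dual vector into a trace pairing. *)
Lemma trace_witness n (J : finType) (K : J -> 'M[C]_n) (c0 : J -> C) U s :
  U = \sum_j c0 j *: K j ->
  (forall c, U = \sum_j c j *: K j -> s <= l1norm c) ->
  exists H : 'M[C]_n, (forall j, normc (\tr (H *m K j)) <= 1) /\
    s <= normc (\tr (H *m U)).
Proof.
move=> Uc0 sU.
pose A : 'M[C]_(#|J|, n * n) := \matrix_i mxvec (K (enum_val i)).
pose comb (x : 'rV[C]_#|J|) := \sum_j x 0 (enum_rank j) *: K j.
have mulA x : x *m A = mxvec (comb x).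
  rewrite mulmx_sum_row linear_sum /= [RHS](reindex _ (onW_bij _ (@enum_val_bij J))).
  by apply: eq_bigr => i _ /=; rewrite rowK enum_valK linearZ.
pose x0 : 'rV[C]_#|J| := \row_i c0 (enum_val i).
have combx0 : comb x0 = U.
  by rewrite Uc0; apply: eq_bigr => j _; rewrite mxE enum_rankK.
have [|h [hA hU]] := @l1_duality _ _ _ A x0 s.
  move=> x; rewrite !mulA combx0 => /(can_inj mxvecK) xU.
  have -> : l1 x = l1norm (fun j => x 0 (enum_rank j)).
    rewrite /l1 /l1norm [RHS](reindex _ (onW_bij _ (@enum_val_bij J))) /=.
    by apply: eq_bigr => i _; rewrite enum_valK.
  exact: sU.
exists (vec_mx h^T)^T; split=> [j|]; last first.
  by rewrite -mxvec_mul_col -combx0 -mulA.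
have := hA (enum_rank j); rewrite -mxvec_mul_col.
have <- : row (enum_rank j) A = mxvec (K j) by rewrite rowK enum_rankK.
by rewrite -row_mul [row _ (A *m h) 0 0]mxE.
Qed.

End TraceFunctionals.

(** * Closure of Gaussian unitaries under adjoints and phases *)

Section GaussianUnitaries.
Variables (R : realType) (n : nat).
Local Notation C := R[i].
Implicit Types V : 'M[C]_(2 ^ n).

Lemma gaussian_unitaryC V : gaussian_unitary V -> gaussian_unitary (V^t*).
Proof.
move=> [Vu [O [OO VO]]]; split; first by rewrite trmxC_unitary.
exists O^T; split=> [|j]; first by rewrite trmxK; exact: mulmx1C.
rewrite trmxCK.
have VV : V^t* *m V = 1%:M by apply: mulmx1C; exact/unitarymxP.
(* Orthogonality inverts the defining relations; conjugation by the adjoint of [V] then cancels [V],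
   leaving the rotation [O^T]. *)
have -> : majorana R n j = \sum_k (O^T j k)%:C *: (V *m majorana R n k *m V^t*).
  under eq_bigr => k _ do rewrite VO scaler_sumr.
  rewrite exchange_big /= (bigD1 j) //= [X in _ + X]big1 ?addr0 => [|l lj].
    under eq_bigr do rewrite scalerA -rmorphM.
    rewrite -scaler_suml -rmorph_sum /=.
    have -> : \sum_i O^T j i * O i j = 1.
      by have /matrixP/(_ j j) := mulmx1C OO; rewrite !mxE eqxx.
    by rewrite scale1r.
  under eq_bigr do rewrite scalerA -rmorphM.
  rewrite -scaler_suml -rmorph_sum /=.
  have -> : \sum_i O^T j i * O i l = 0.
    by have /matrixP/(_ j l) := mulmx1C OO; rewrite !mxE eq_sym (negPf lj).
  by rewrite scale0r.
rewrite mulmx_sumr mulmx_suml; apply: eq_bigr => k _.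
by rewrite -scalemxAr -scalemxAl !mulmxA VV mul1mx -mulmxA VV mulmx1.
Qed.

Lemma gaussian_unitaryZ (w : C) V :
  normc w = 1 -> gaussian_unitary V -> gaussian_unitary (w *: V).
Proof.
move=> w1 [Vu [O [OO VO]]].
have ww : w * w^* = 1 by rewrite mulc_conj w1 expr1n.
split; last exists O; last split=> // j.
  apply/unitarymxP; rewrite trmxCZ -scalemxAl -scalemxAr scalerA ww scale1r.
  exact/unitarymxP.
by rewrite trmxCZ -!scalemxAl -scalemxAr scalerA ww scale1r VO.
Qed.

End GaussianUnitaries.

(** Nonnegativity covers the case without a least element, where [min_of] takes its default value
    0. *)
Lemma min_of_le (R : realType) (A : set R) x :
  (forall y, A y -> 0 <= y) -> A x -> min_of A <= x.
Proof.
move=> A0 Ax; rewrite /min_of; case: xgetP => [y _ [_ lby]|_]; first exact: lby.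
exact: A0.
Qed.

(** * Comparison of unitary extent and fermionic nonlinearity *)

Section Nonlinearity.
Variables (R : realType) (n : nat).
Local Notation C := R[i].
Implicit Types U : 'M[C]_(2 ^ n).

Lemma l1norm_ge0 (J : finType) (c : J -> C) : 0 <= l1norm c.
Proof. by apply: sumr_ge0 => j _; exact: normc_ge0. Qed.

Lemma unitary_extent_le U (J : finType) (c : J -> C) K :
  unitary_decomposition U c K -> unitary_extent U <= l1norm c ^+ 2.
Proof.
move=> [Kg UK]; apply: min_of_le => [_ [m [d [L [_ ->]]]]|]; first exact: sqr_ge0.
exists #|J|, (c \o enum_val), (K \o enum_val); split; first split=> [j|].
- exact: Kg.
- by rewrite UK (reindex _ (onW_bij _ (@enum_val_bij J))).
- by rewrite /l1norm (reindex _ (onW_bij _ (@enum_val_bij J))).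
Qed.

(** [mxtrace_mulE] exposes the channel on matrix units, where its decomposition is substituted; read
    backwards, it reassembles each term. *)
Lemma channel_trace U (H : 'M[C]_(2 ^ n)) (J : finType) (q : J -> C) K L :
  channel_decomposition (unitary_channel U) q K L ->
  \tr (H *m U) * (\tr (H *m U))^* =
  \sum_j q j * (\tr (H *m K j) * (\tr (H *m (L j)^t*))^*).
Proof.
move=> [_ _ UE]; rewrite -mxtrace_trmxC trmxC_mul mxtrace_mulE.
under [RHS]eq_bigr do
  rewrite -mxtrace_trmxC trmxC_mul trmxCK mxtrace_mulE mulr_sumr.
rewrite [RHS]exchange_big /=; apply: eq_bigr => a _.
under [RHS]eq_bigr do rewrite mulr_sumr.
rewrite [RHS]exchange_big /=; apply: eq_bigr => b _.
have -> : H *m U *m delta_mx a b *m (U^t* *m H^t*) =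
    H *m unitary_channel U (delta_mx a b) *m H^t* by rewrite !mulmxA.
rewrite UE mulmx_sumr !mulmx_suml raddf_sum; apply: eq_bigr => j _ /=.
by rewrite -scalemxAr -!scalemxAl linearZ /= !mulmxA.
Qed.

Lemma extent_le_channel U (I J : finType) (c : I -> C) V (q : J -> R) K L :
  optimal_unitary_decomposition U c V ->
  channel_decomposition (unitary_channel U) (fun j => (q j)%:C) K L ->
  unitary_extent U <= \sum_j `|q j|.
Proof.
move=> [[Vg UV] Uc] UE; have [Kg Lg _] := UE.
(* The witness must be bounded on all of these at once. Including the [V i], with [c] extended by
   zero, ensures that the atoms span [U]. *)
pose atom (x : I + (J + J)) := match x with
  | inl i => V i | inr (inl j) => K j | inr (inr j) => (L j)^t* end.
pose c0 (x : I + (J + J)) := if x is inl i then c i else 0.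
have atomg x : gaussian_unitary (atom x).
  by case: x => [i|[j|j]] //=; exact: gaussian_unitaryC.
have [||H [Hatom HU]] := @trace_witness _ _ _ atom c0 U (l1norm c).
- rewrite big_sumType /= -UV big1 ?addr0 // => j _; exact: scale0r.
(* Every combination of atoms equal to [U] is a Gaussian decomposition, so optimality of [c] bounds
   its cost from below. *)
- move=> d Ud; rewrite -ler_sqr ?nnegrE ?l1norm_ge0 // -Uc.
  exact: unitary_extent_le (conj atomg Ud).
rewrite Uc; apply: le_trans (_ : normc (\tr (H *m U)) ^+ 2 <= _).
  by rewrite ler_sqr ?nnegrE ?l1norm_ge0 ?normc_ge0.
have -> : normc (\tr (H *m U)) ^+ 2 = normc (\tr (H *m U) * (\tr (H *m U))^*).
  by rewrite mulc_conj normc_real ger0_norm ?sqr_ge0.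
rewrite (channel_trace H UE); apply: le_trans (normc_sum _) _.
apply: ler_sum => j _; rewrite !ComplexField.Normc.normcM normc_real normc_conj.
rewrite -[leRHS]mulr1 ler_wpM2l // mulr_ile1 ?normc_ge0 //.
  exact: Hatom (inr (inl j)).
exact: Hatom (inr (inr j)).
Qed.

Lemma polar_decomposition (z : C) : exists2 w, normc w = 1 & z = (normc z)%:C * w.
Proof.
have [->|z0] := eqVneq z 0.
  by exists 1; rewrite ?(normc_real 0) ?(normc_real 1) ?normr1 ?normr0 ?mul0r.
have nz0 : (normc z)%:C != 0 by rewrite -norm_normc normr_eq0.
exists (z / (normc z)%:C); last by rewrite mulrCA divff ?mulr1.
apply: complexI; rewrite -[LHS]norm_normc normf_div.
by rewrite -norm_normc normr_id divff ?normr_eq0.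
Qed.

(** The phase of each coefficient moves into the left Gaussian factor, and its modulus remains as a
    real coefficient. *)
Lemma channel_decomposition_real E (J : finType) (q : J -> C) K L :
  channel_decomposition (n := n) E q K L ->
  exists (m : nat) (r : 'I_m -> R) K' L',
   channel_decomposition E (fun j => (r j)%:C) K' L' /\ l1norm q = \sum_j `|r j|.
Proof.
move=> [Kg Lg EX].
have /fin_all_exists2[w w1 qw] := fun j => polar_decomposition (q j).
exists #|J|, (fun i => normc (q (enum_val i))).
exists (fun i => w (enum_val i) *: K (enum_val i)), (L \o enum_val).
split; first split=> [j|j|X].
- exact: gaussian_unitaryZ.
- exact: Lg.
- rewrite EX (reindex _ (onW_bij _ (@enum_val_bij J))) /=.
  by apply: eq_bigr => i _; rewrite -!scalemxAl scalerA -qw.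
rewrite /l1norm (reindex _ (onW_bij _ (@enum_val_bij J))) /=.
by apply: eq_bigr => i _; rewrite ger0_norm ?normc_ge0.
Qed.

Lemma unitary_channel_decomposition U (J : finType) (c : J -> C) V :
  unitary_decomposition U c V ->
  channel_decomposition (unitary_channel U)
    (fun jk : J * J => c jk.1 * (c jk.2)^*)
    (fun jk => V jk.1) (fun jk => (V jk.2)^t*).
Proof.
move=> [Vg UV]; split=> [j|j|X]; [exact: Vg | exact/gaussian_unitaryC/Vg |].
rewrite /unitary_channel UV trmxC_sum !mulmx_suml.
rewrite -(pair_bigA _ (fun j k => (c j * (c k)^*) *: (V j *m X *m (V k)^t*))) /=.
apply: eq_bigr => j _; rewrite mulmx_sumr; apply: eq_bigr => k _.
by rewrite trmxCZ -!scalemxAl -scalemxAr scalerA.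
Qed.

Lemma l1norm_conj_mul (J : finType) (c : J -> C) :
  l1norm (fun jk : J * J => c jk.1 * (c jk.2)^*) = l1norm c ^+ 2.
Proof.
rewrite /l1norm -(pair_bigA _ (fun j k => normc (c j * (c k)^*))) /=.
rewrite expr2 mulr_suml; apply: eq_bigr => j _; rewrite mulr_sumr.
by apply: eq_bigr => k _; rewrite ComplexField.Normc.normcM normc_conj.
Qed.

(** The minimum is attained: the expanded product decomposition, made real, costs exactly the
    squared l1 norm of [c]. *)
Lemma nonlinearity_unitary_channel U (J : finType) (c : J -> C) V :
  optimal_unitary_decomposition U c V ->
  nonlinearity (unitary_channel U) = unitary_extent U.
Proof.
move=> UV; apply: min_ofE => [|_ [m [q [K [L [UE ->]]]]]]; last first.
  exact: extent_le_channel UV UE.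
have := channel_decomposition_real (unitary_channel_decomposition UV.1).
by rewrite l1norm_conj_mul -UV.2.
Qed.

End Nonlinearity.

Theorem lemma25 (R : realType) (U : 'M[R[i]]_(2 ^ 2)) (chi : nat)
    (c : 'I_chi -> R[i]) (V : 'I_chi -> 'M[R[i]]_(2 ^ 2)) :
  U \is unitarymx ->
  optimal_unitary_decomposition U c V ->
  state_extent (choi_state U) = unitary_extent U ->
  optimal_channel_decomposition (n := 2) (unitary_channel U)
    (fun jk : 'I_chi * 'I_chi => c jk.1 * (c jk.2)^*)
    (fun jk => V jk.1) (fun jk => (V jk.2)^t* ) /\
  nonlinearity (n := 2) (unitary_channel U) = unitary_extent U.
Proof.
move=> _ UV _; have PhiU := nonlinearity_unitary_channel UV; split=> //.
split; first exact: (unitary_channel_decomposition UV.1).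
by rewrite PhiU UV.2 l1norm_conj_mul.
Qed.
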